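(* Let $(X,r)$ be an indecomposable solution of size $|X|=pq$, where $p<q$ are prime numbers. Then either all terms of the $T$-partition of $(X,r)$ are multiples of $q$, or at least one term of the $T$-partition is a multiple of $p$.
   Context: A solution $(X,r)$ is a non-empty finite set $X$, with $|X|>1$, together with an involutive map $r\colon X\times X\to X\times X$, $r(x,y)=(\sigma_x(y),\tau_y(x))$, satisfying $r_1r_2r_1=r_2r_1r_2$ on $X^3$, where $r_1=r\times \mathrm{Id}_X$ and $r_2=\mathrm{Id}_X\times r$, and such that all maps $\sigma_x$ and $\tau_x$ ($x\in X$) are bijections of $X$. A solution is decomposable if $X=Y\sqcup Z$ with $Y,Z$ non-empty and disjoint, $r(Y\times Y)=Y\times Y$ and $r(Z\times Z)=Z\times Z$; equivalently, if the permutation group $\mathcal{G}(X,r)$ generated by all $\sigma_x$, $x\in X$, does not act transitively on $X$. Otherwise it is indecomposable. The diagonal map of $(X,r)$ is the permutation $T\colon X\to X$, $T(x)=\tau_x^{-1}(x)$. The $T$-partition of $(X,r)$ is the partition of the integer $|X|$ given by the multiset of sizes of the $T$-orbits in $X$ (fixed points counted as orbits of size $1$). *)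

(* Defs.v *)
From mathcomp Require Import all_boot all_fingroup.

Set Implicit Arguments.
Unset Strict Implicit.
Unset Printing Implicit Defensive.

(* r x Id_X and Id_X x r on X^3, where X^3 is X * X * X = (X * X) * X. *)
Definition ybe_r1 (X : Type) (r : X * X -> X * X) (u : X * X * X) : X * X * X :=
  let: (x, y, z) := u in (r (x, y), z).

Definition ybe_r2 (X : Type) (r : X * X -> X * X) (u : X * X * X) : X * X * X :=
  let: (x, y, z) := u in (x, (r (y, z)).1, (r (y, z)).2).

(* Writing r (x, y) = (sigma_x y, tau_y x). *)
Definition sigma_fun (X : Type) (r : X * X -> X * X) (x y : X) : X := (r (x, y)).1.

Definition tau_fun (X : Type) (r : X * X -> X * X) (y x : X) : X := (r (x, y)).2.

Record solution (X : finType) := Solution {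
  sol_map :> X * X -> X * X;
  sol_card : 1 < #|X|;
  sol_invol : involutive sol_map;
  sol_ybe : ybe_r1 sol_map \o ybe_r2 sol_map \o ybe_r1 sol_map
              =1 ybe_r2 sol_map \o ybe_r1 sol_map \o ybe_r2 sol_map;
  sol_sigma_bij : forall x, bijective (sigma_fun sol_map x);
  sol_tau_bij : forall x, bijective (tau_fun sol_map x) }.

Definition decomposable (X : finType) (r : solution X) : Prop :=
  exists Y Z : {set X},
    [/\ Y != set0, Z != set0, [disjoint Y & Z] & Y :|: Z = [set: X]] /\
    [/\ r @: setX Y Y = setX Y Y & r @: setX Z Z = setX Z Z].

Definition indecomposable (X : finType) (r : solution X) : Prop := ~ decomposable r.

Definition sigma (X : finType) (r : solution X) (x : X) : {perm X} :=
  perm (bij_inj (sol_sigma_bij r x)).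

Definition tau (X : finType) (r : solution X) (x : X) : {perm X} :=
  perm (bij_inj (sol_tau_bij r x)).

Definition diag_fun (X : finType) (r : solution X) (x : X) : X := ((tau r x)^-1)%g x.

(* The left inverse of the diagonal map is x |-> sigma_x^-1(x). *)
Lemma diag_fun_inj (X : finType) (r : solution X) : injective (diag_fun r).
Proof.
apply: (can_inj (g := fun x => ((sigma r x)^-1)%g x)) => x.
set z := diag_fun r x.
have tz : tau r x z = x by rewrite /z /diag_fun permKV.
apply: (perm_inj (s := sigma r z)); rewrite permKV.
have rzx : r (z, x) = (sigma r z x, x).
  by rewrite [LHS]surjective_pairing -{4}tz !permE.
have := sol_invol r (z, x); rewrite rzx => rsx.
have ts : tau r x (sigma r z x) = x by rewrite permE /tau_fun rsx.
by apply: (perm_inj (s := tau r x)); rewrite ts tz.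
Qed.

Definition diag (X : finType) (r : solution X) : {perm X} := perm (@diag_fun_inj X r).

(* An integer partition, as the nonincreasing sequence of its terms. *)
Definition T_partition (X : finType) (r : solution X) : seq nat :=
  sort geq [seq #|B| | B : {set X} in porbits (diag r)].

(* Main.v *)
Require Import Defs.
From mathcomp Require Import all_boot all_fingroup all_solvable.
From mathcomp Require Import integral_char.

Set Implicit Arguments.
Unset Strict Implicit.
Unset Printing Implicit Defensive.
Local Open Scope group_scope.

(** The proof rests on a second, abelian, group law on the permutation group
    $\Gamma$ of the solution. Write $L_x = \sigma_x^{-1}$. The braid equation
    gives the cycle set identity $L_{L_x y} L_x = L_{L_y x} L_y$, which says
    that the maps [shift x : g |-> g * L (g x)] of the symmetric group commute.
    They generate an abelian group $V$ whose orbit of 1 is $\Gamma$: the addition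
    of the brace structure of $\Gamma$ is the action of $V$.

    For a set $\pi$ of primes, the orbit of 1 under the $\pi$-part of $V$ has
    $|\Gamma|_\pi$ elements, and it is also a subgroup of $\Gamma$ for the
    composition ([part_group_set]), because left translations normalize $V$. So
    $\Gamma$ has distinguished Hall subgroups $\Gamma_\pi$ ([part_Hall]), and
    $\Gamma_\pi$ is generated by one element $u_x$ for each point $x$
    ([part_sub_gen]). As $u_x$ comes from a power of [shift x], it maps $x$ to
    an iterate of $T^{-1}$ at $x$, and it fixes $x$ if no prime of $\pi$ divides
    the size of the $T$-orbit of $x$ ([part_gen_fix]).

    Let $|X| = pq$, suppose that $p$ divides no term of the $T$-partition and
    that $q$ does not divide the size of the $T$-orbit of $x_0$. The group
    $G = \Gamma_{\{p,q\}}$ is still transitive, its index in $\Gamma$ being prime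
    to $pq$; let $P = \Gamma_{\{p\}}$ and $Q = \Gamma_{\{q\}}$ be its
    distinguished Sylow subgroups. Then $P$ is generated by elements each of
    which fixes a point, and the generator $u_{x_0}$ of $Q$ fixes $x_0$.

    Permutation group theory now shows that $Q$ is semiregular
    ([Sylow_semiregular]). By Burnside's theorem $G$ is solvable, so it has a
    nontrivial normal subgroup $N$ that is a $p$-group or a $q$-group, and the
    orbits of $N$ are blocks. If they have size $q$, then each of the generators
    of $P$ fixes some block, hence every block since $P$ permutes the $p$ blocks
    cyclically; but $P$ is transitive on the blocks. If they have size $p$, then
    $Q$ permutes the $q$ blocks cyclically, and since $p < q$ its orbits on $X$
    have size $q$ too, so an element of $Q$ that fixes a point fixes all blocks,
    and then all points.

    Therefore $u_{x_0} = 1$; by equivariance all the generators of $Q$ are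
    trivial ([part_gen_eq1]), and $Q = 1$, although $q$ divides the order of
    $G$. *)

(** * The additive group of a cycle set *)

(** Taking $\pi$-parts is a morphism on an abelian group, and it is the
    identity on the $\pi$-core. *)
Lemma mem_gen_constt (gT : finGroupType) (I : finType) (d : I -> gT)
    (pi : nat_pred) (z : gT) :
    abelian <<[set d i | i : I]>> -> z \in 'O_pi(<<[set d i | i : I]>>) ->
  z \in <<[set (d i).`_pi | i : I]>>.
Proof.
set V := <<_>>; set W := <<_>> => abV Vz.
have VzV : z \in V by apply: subsetP Vz; exact: pcore_sub.
rewrite -(constt_p_elt (mem_p_elt (pcore_pgroup pi V) Vz)).
have gW : group_set [set v in V | v.`_pi \in W].
  apply/group_setP; split=> [|a b]; first by rewrite inE group1 constt1 group1.
  rewrite !inE => /andP[aV aW] /andP[bV bW].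
  by rewrite groupM // consttM ?groupM //; exact: (centsP abV).
have /subsetP/(_ _ VzV): V \subset Group gW.
  rewrite gen_subG; apply/subsetP=> _ /imsetP[i _ ->]; rewrite inE.
  by apply/andP; split; apply: mem_gen; apply: imset_f.
by rewrite inE => /andP[].
Qed.

Section CycleSet.

Variables (X : finType) (L : X -> {perm X}).
Hypothesis cycleL : forall x y, L x * L (L x y) = L y * L (L y x).
Hypothesis squareL_inj : injective (fun x => L x x).

(** With $g$ seen as an element of the brace, this is the addition of the
    generator attached to $x$. *)
Definition shift_fun x (g : {perm X}) := g * L (g x).

(** From the image of $g$, the value $g(x)$ is recovered by looking at $x$,
    since $y \mapsto L_y(y)$ is injective; then $g$ itself is recovered. *)
Lemma shift_fun_inj x : injective (shift_fun x).
Proof.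
move=> g h gh; have gxhx : g x = h x.
  by apply: squareL_inj; move/permP/(_ x): gh; rewrite !permM.
by move: gh; rewrite /shift_fun gxhx => /mulIg.
Qed.

Definition shift x : {perm {perm X}} := perm (@shift_fun_inj x).

Lemma shiftE x g : shift x g = g * L (g x).
Proof. by rewrite permE. Qed.

Definition shifts : {group {perm {perm X}}} := <<[set shift x | x : X]>>%G.

Lemma mem_shifts x : shift x \in shifts.
Proof. by apply: mem_gen; apply: imset_f. Qed.

Lemma shifts_abelian : abelian shifts.
Proof.
rewrite abelian_gen; apply/centsP=> _ /imsetP[x _ ->] _ /imsetP[y _ ->].
apply/permP=> g.
by rewrite !permM !shiftE !permM -!mulgA cycleL.
Qed.

Definition lmul (h : {perm X}) : {perm {perm X}} := perm (mulgI h).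

Lemma lmulE h g : lmul h g = h * g. Proof. by rewrite permE. Qed.

(** Adding after composing with $h$: the distributivity law of the brace. *)
Lemma shiftJ (h : {perm X}) x : shift (h x) ^ lmul h = shift x.
Proof.
apply/permP=> g; rewrite -[g](mulKVg h) -{1}lmulE permJ lmulE !shiftE.
by rewrite [in RHS]permM !mulgA.
Qed.

Lemma lmul_norm h : lmul h \in 'N(shifts).
Proof.
apply: (subsetP (norm_gen _)); apply/normP; rewrite /=.
apply/eqP; rewrite eqEcard cardJg leqnn andbT; apply/subsetP=> s.
case/imsetP=> _ /imsetP[x _ ->] ->.
by rewrite -[x](permKV h) shiftJ imset_f.
Qed.

Section Part.

Variable pi : nat_pred.

Definition part_set : {set {perm X}} := orbit 'P 'O_pi(shifts) 1.

(** If $g = w(1)$ and $h = w'(1)$ then $gh$ is the image of $g$ under the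
    conjugate of $w'$ by the left translation by $g$, which is again in the
    $\pi$-core since that core is characteristic. *)
Lemma part_group_set : group_set part_set.
Proof.
apply/group_setP; split=> [|g h]; first exact: orbit_refl.
move=> gA /orbitP[w Ww <-].
have Nl := subsetP (char_norms (pcore_char pi _)) _ (lmul_norm g).
apply: orbit_trans (gA); apply/orbitP; exists (w ^ lmul g).
  by rewrite memJ_norm.
by rewrite /= !apermE -[X in _ X = _]mulg1 -[in LHS]lmulE permJ lmulE.
Qed.

Definition part := Group part_group_set.

(** The $\pi$-component, for the addition, of the generator attached to $x$. *)
Definition part_gen x : {perm X} := (shift x).`_pi 1.

(** Conjugation by the left translation by $g$ reduces this to the value at 1,
    which is the definition of [part_gen]. *)
Lemma constt_shiftE x g : (shift x).`_pi g = g * part_gen (g x).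
Proof.
transitivity (((shift (g x)).`_pi ^ lmul g) (lmul g 1)).
  by rewrite -consttJ shiftJ lmulE mulg1.
by rewrite permJ lmulE.
Qed.

Lemma constt_shift_pcore x : (shift x).`_pi \in 'O_pi(shifts).
Proof.
rewrite (mem_Hall_pcore (nilpotent_pcore_Hall pi (abelian_nil shifts_abelian))).
  exact: p_elt_constt.
by rewrite groupX // mem_shifts.
Qed.

Lemma mem_part_gen x : part_gen x \in part.
Proof. by apply/orbitP; exists ((shift x).`_pi); rewrite ?constt_shift_pcore. Qed.

(** The $\pi$-core of the shifts is generated by the $\pi$-parts of the shifts,
    and by [constt_shiftE] each of these acts on $g$ by composing it with some
    [part_gen y]. *)
Lemma part_sub_gen : part \subset <<[set part_gen x | x : X]>>.
Proof.
apply/subsetP=> _ /orbitP[w Ww <-]; rewrite /= apermE.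
set U := <<_>>.
have gst : group_set [set w : {perm {perm X}} | [forall g in U, w g \in U]].
  apply/group_setP; split=> [|a b].
    by rewrite inE; apply/forall_inP=> g; rewrite perm1.
  rewrite !inE => /forall_inP aU /forall_inP bU; apply/forall_inP=> g Ug.
  by rewrite permM bU ?aU.
have: w \in Group gst.
  apply: subsetP (mem_gen_constt shifts_abelian Ww).
  rewrite gen_subG; apply/subsetP=> _ /imsetP[x _ ->]; rewrite inE.
  apply/forall_inP=> g Ug; rewrite constt_shiftE groupM // mem_gen //.
  exact: imset_f.
by rewrite inE => /forall_inP; apply.
Qed.

(** The permutation [(shift x ^+ k) 1] is the inverse of $\sigma_x$ for the
    $k$-fold cabling of the solution, whose diagonal map is $T^k$. *)
Lemma shift_iterE x k : (shift x ^+ k) 1 x = iter k (fun y => L y y) x.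
Proof.
elim: k => [|k IH]; first by rewrite expg0 !perm1.
by rewrite expgSr permM shiftE permM IH.
Qed.

(** The number $t$ is the size of the $T$-orbit of $x$. It divides the order of
    [shift x], hence the $\pi'$-part of that order, which divides the exponent
    $e$ such that the $\pi$-part of [shift x] is [shift x ^+ e]. *)
Lemma part_gen_fix (t : nat) x :
    (forall k, (iter k (fun y => L y y) x == x) = (t %| k)) -> pi^'.-nat t ->
  part_gen x x = x.
Proof.
move=> iterP pi't; rewrite /part_gen /constt shift_iterE; apply/eqP; rewrite iterP.
have t_ord : t %| #[shift x].
  by rewrite -iterP -shift_iterE expg_order !perm1.
have t_part : t %| #[shift x]`_pi^'.
  by rewrite -(part_pnat_id pi't) partn_dvd.
apply: dvdn_trans t_part _; rewrite /dvdn chinese_modr ?mod0n //.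
exact: coprime_partC.
Qed.

(** If the $\pi$-part of [shift x] fixes 1, then it fixes the whole orbit of 1
    under the abelian group of shifts, in particular $g$; and it maps $g$ to
    [g * part_gen (g x)]. *)
Lemma part_gen_eq1 x g :
  part_gen x = 1 -> g \in orbit 'P shifts 1 -> part_gen (g x) = 1.
Proof.
move=> dx1 /orbitP[w Vw <-]; rewrite /= apermE.
have := constt_shiftE x (w 1); rewrite -permM.
rewrite -(centsP shifts_abelian _ (groupX _ (mem_shifts x)) _ Vw) permM.
rewrite -[X in w X]/(part_gen x) dx1 => w1.
by apply: (mulgI (w 1)); rewrite mulg1 -w1.
Qed.

End Part.

(** The group of shifts need not act faithfully on the orbit of 1, so the
    stabilizer of 1 has to be divided out; in an abelian group, a Hall subgroup
    meets it in a Hall subgroup of it. *)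
Lemma part_Hall (pi rho : nat_pred) :
  {subset pi <= rho} -> pi.-Hall(part rho) (part pi).
Proof.
move=> pi_rho; set V := shifts.
have nilV := abelian_nil shifts_abelian; have sOV := sub_pcore V pi_rho.
have HallO : pi.-Hall('O_rho(V)) 'O_pi(V).
  exact: pHall_subl sOV (pcore_sub _ _) (nilpotent_pcore_Hall pi nilV).
have sAB : part pi \subset part rho.
  by apply/subsetP=> _ /orbitP[w Ww <-]; apply/orbitP; exists w; rewrite ?(subsetP sOV).
set C := 'C_('O_rho(V))[1 : {perm X} | 'P].
have HallC : pi.-Hall(C) ('O_pi(V) :&: C).
  apply: setI_normal_Hall HallO (subsetIl _ _).
  by rewrite -sub_abelian_normal ?(abelianS (pcore_sub _ _) shifts_abelian).
have cardO : #|part rho| = #|'O_rho(V) : C| by exact: card_orbit.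
have cardP : #|part pi| = #|'O_pi(V) : 'O_pi(V) :&: C|.
  rewrite /= card_orbit; congr #|_ : _|; rewrite /C setIA.
  by rewrite (setIidPl sOV).
rewrite pHallE sAB /= cardP cardO.
rewrite -(eqn_pmul2l (cardG_gt0 ('O_pi(V) :&: C))) Lagrange ?subsetIl //.
rewrite (card_Hall HallC) (card_Hall HallO) -partnM ?cardG_gt0 ?indexg_gt0 //.
by rewrite Lagrange ?subsetIl.
Qed.

Lemma part_predT : part predT = orbit 'P shifts 1 :> {set _}.
Proof. by rewrite /= /part_set pcore_pgroup_id //; apply/pnatP. Qed.

Lemma mem_part_predT x : L x \in part predT.
Proof.
suff <-: part_gen predT x = L x by exact: mem_part_gen.
rewrite /part_gen constt_p_elt ?shiftE ?mul1g ?perm1 //.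
exact/pnatP.
Qed.

End CycleSet.

(** * Transitive groups of degree a product of two primes *)

(** As $PH = G$, the intersection has index $r$ in the $r$-group $P$, so it is
    normal there; and every conjugate of $H$ in $G$ is a conjugate by an element
    of $P$. *)
Lemma Sylow_cap_conj (gT : finGroupType) (G H P : {group gT}) (r : nat) :
    prime r -> r.-Sylow(G) P -> H \subset G -> #|G : H| = r ->
  #|P : P :&: H| = r /\ {in G, forall g, P :&: H :^ g = P :&: H}.
Proof.
move=> r_pr sylP sHG iGH; have [sPG rP r'GP] := and3P sylP.
have HP : H * P = G.
  by apply: coprime_index_mulG; rewrite // iGH (pnat_coprime (pnat_id r_pr)).
have iP : #|P : P :&: H| = r.
  rewrite indexgI -iGH; apply/eqP.
  by rewrite -(eqn_pmul2l (cardG_gt0 H)) LagrangeMl HP Lagrange.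
split=> // g; rewrite -HP => /mulsgP[h a Hh Pa ->].
have nM : P :&: H <| P.
  apply: (p_maximal_normal rP); apply: p_index_maximal; first exact: subsetIl.
  by rewrite iP.
by rewrite conjsgM (conjGid Hh) -{1}(conjGid Pa) -conjIg (normsP (normal_norm nM)).
Qed.

Section Transitive.

Variables (X : finType) (G : {group {perm X}}).
Hypothesis Gtr : [transitive G, on [set: X] | 'P].

Lemma index_point_stab x : #|G : 'C_G[x | 'P]| = #|X|.
Proof. by rewrite -card_orbit (atransP Gtr) ?inE // cardsT. Qed.

Lemma point_stabJ x y : exists2 g, g \in G & 'C[y | 'P] = 'C[x | 'P] :^ g.
Proof.
have /orbitP[g Gg <-] : y \in orbit 'P G x by rewrite (atransP Gtr) inE.
by exists g; rewrite ?astab1_act.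
Qed.

Lemma all_fix_eq1 (g : {perm X}) : (forall x, g \in 'C[x | 'P]) -> g = 1.
Proof.
move=> gfix; apply/permP=> x; rewrite perm1.
by have /astab1P := gfix x.
Qed.

Lemma normal_point_stab_eq1 (N : {group {perm X}}) x :
  N <| G -> N \subset 'C[x | 'P] -> N :=: 1.
Proof.
move=> nNG sNx; apply/trivgP/subsetP=> n Nn; apply/set1P/all_fix_eq1=> y.
have [g Gg ->] := point_stabJ x y; apply: subsetP Nn.
by rewrite -(normsP (normal_norm nNG) _ Gg) conjSg.
Qed.

(** Here $N G_x$ is the stabilizer of the block $xN$. The size $|N : N \cap G_x|$
    of the block is a power of $r$ dividing $rs$, and it is not 1 since a normal
    subgroup that fixes a point is trivial. *)
Lemma block_stab_index (N : {group {perm X}}) (r s : nat) x :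
    prime r -> prime s -> r != s -> #|X| = (r * s)%N ->
    N <| G -> r.-group N -> N :!=: 1 ->
  #|G : N <*> 'C_G[x | 'P]| = s.
Proof.
move=> r_pr s_pr rs cardX nNG rN ntN; set C := 'C_G[x | 'P].
have [sNG nNG'] := andP nNG; have sCG : C \subset G := subsetIl _ _.
have sHG : N <*> C \subset G by rewrite join_subG sNG.
have iHC : #|N <*> C : C| = #|N : C|.
  apply/eqP; rewrite -(eqn_pmul2l (cardG_gt0 C)) Lagrange ?joing_subr //.
  by rewrite mulnC LagrangeMr /= norm_joinEr ?(subset_trans sCG).
have iGHC : (#|G : N <*> C| * #|N : C|)%N = (r * s)%N.
  by rewrite -iHC Lagrange_index ?joing_subr // index_point_stab.
suff iNC : #|N : C| = r.
  by apply/eqP; rewrite -(eqn_pmul2l (prime_gt0 r_pr)) -iGHC iNC mulnC.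
have rNC : r.-nat #|N : C| by rewrite -indexgI (pnat_dvd (dvdn_indexg _ _)).
have : #|N : C| %| r.
  rewrite -(@Gauss_dvdl _ r s) -?iGHC ?dvdn_mull //.
  by rewrite (pnat_coprime rNC) // pnatE // inE /= inE eq_sym.
have [_ r_div] := primeP r_pr; case/r_div/orP=> [|/eqP//]; rewrite indexg_eq1 => sNC.
case/eqP: ntN; apply: (@normal_point_stab_eq1 _ x) => //.
by rewrite (subset_trans sNC) ?subsetIr.
Qed.

(** The subgroups $H_x = N G_x$, for $N$ a minimal normal subgroup, are the block
    stabilizers. By [Sylow_cap_conj], an element of the relevant Sylow subgroup
    that fixes one block fixes all of them. *)
Lemma Sylow_semiregular (p q : nat) (P Q : {group {perm X}}) :
    prime p -> prime q -> p < q -> #|X| = (p * q)%N ->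
    (pred2 p q).-group G -> p.-Sylow(G) P -> q.-Sylow(G) Q ->
    P \subset <<\bigcup_x 'C_P[x | 'P]>> ->
  forall x, 'C_Q[x | 'P] = 1.
Proof.
move=> p_pr q_pr lt_pq cardX pqG sylP sylQ genP x0.
have p_neq_q : p != q by rewrite neq_ltn lt_pq.
have solG : solvable G.
  apply: Burnside_p_a_q_b; apply: (@uniq_leq_size _ _ [:: p; q]).
    exact: primes_uniq.
  by move=> r r_G; have := pnatPpi pqG r_G; rewrite !inE.
have ntG : G :!=: 1.
  apply/eqP=> G1; have := dvdn_indexg G 'C_G[x0 | 'P].
  rewrite index_point_stab cardX G1 cards1 dvdn1 muln_eq1 => /andP[/eqP p1 _].
  by rewrite p1 in p_pr.
have [N minN sNG] := minnormal_exists ntG (normG G).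
have [nNG ntN /is_abelemP[r r_pr /abelem_pgroup rN]] :=
  minnormal_solvable minN sNG solG.
have nN : N <| G by rewrite /normal sNG.
pose H x := (N <*> 'C_G[x | 'P])%G.
have sHG x : H x \subset G by rewrite join_subG sNG subsetIl.
have HJ x y : exists2 g, g \in G & H y = (H x :^ g)%G.
  have [g Gg yg] := point_stabJ x y; exists g => //; apply/val_inj.
  by rewrite /= conjYg (normsP nNG) // conjIg conjGid // yg.
have capH (l : nat) (R : {group {perm X}}) x y : prime l ->
    l.-Sylow(G) R -> #|G : H x| = l -> #|R : R :&: H x| = l /\ R :&: H y = R :&: H x.
  move=> l_pr sylR iH; have [iR capR] := Sylow_cap_conj l_pr sylR (sHG x) iH.
  by split=> //; have [g Gg ->] := HJ x y; exact: capR.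
have [sPG pP _] := and3P sylP; have [sQG qQ q'Q] := and3P sylQ.
have capCH (R : {group {perm X}}) x : R \subset G -> 'C_R[x | 'P] \subset R :&: H x.
  move=> sRG; rewrite subsetI subsetIl /=.
  exact: subset_trans (setSI _ sRG) (joing_subr _ _).
have : r \in pred2 p q.
  have [_ r_dvd _] := pgroup_pdiv rN ntN.
  exact: (pgroupP (pgroupS sNG pqG)).
case/pred2P=> def_r; rewrite {r}def_r in r_pr rN.
  (* Blocks of size p: the stabilizers of x and of its block agree in Q. *)
  have iH x : #|G : H x| = q.
    exact: block_stab_index nN rN ntN.
  have iC x : #|Q : 'C_Q[x | 'P]| = q.
    have q_dvd : q %| #|Q : 'C_Q[x | 'P]|.
      rewrite -(@Gauss_dvdr _ #|G : Q|); last by rewrite (pnat_coprime (pnat_id q_pr)).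
      rewrite Lagrange_index ?subsetIl //.
      rewrite -(Lagrange_index (subsetIl G 'C[x | 'P])) ?setSI //.
      by rewrite index_point_stab cardX dvdn_mulr ?dvdn_mull.
    have [m im] := p_natP (pnat_dvd (dvdn_indexg Q 'C_Q[x | 'P]) qQ).
    (* The orbit of x under Q has at most pq < q ^ 2 points. *)
    have: q ^ m < q ^ 2.
      rewrite -im -card_orbit (leq_ltn_trans (max_card _)) // cardX.
      by rewrite ltn_pmul2r ?prime_gt0.
    rewrite ltn_exp2l ?prime_gt1 //; move: im q_dvd.
    by case: m => [|[|]] // -> ; rewrite dvdn1 => /eqP q1; rewrite q1 in q_pr.
  have CH x : 'C_Q[x | 'P] = Q :&: H x.
    have [iQ _] := capH q Q x x q_pr sylQ (iH x).
    apply/eqP; rewrite eqEcard capCH //= -(leq_pmul2r (prime_gt0 q_pr)).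
    by rewrite -{1}iQ -(iC x) !Lagrange ?subsetIl.
  apply/trivgP/subsetP=> v Cv; apply/set1P/all_fix_eq1=> y.
  have [_ Qxy] := capH q Q x0 y q_pr sylQ (iH x0).
  by move: Cv; rewrite /= CH -Qxy -CH => /setIP[].
(* Blocks of size q: P would fix the block of x0. *)
have iH x : #|G : H x| = p.
  by apply: block_stab_index nN rN ntN; rewrite // 1?eq_sym // mulnC.
have [iP _] := capH p P x0 x0 p_pr sylP (iH x0).
have sPH : P \subset H x0.
  apply: subset_trans genP _; rewrite gen_subG; apply/bigcupsP=> y _.
  have [_ Pxy] := capH p P x0 y p_pr sylP (iH x0).
  by rewrite (subset_trans (capCH P y sPG)) // Pxy subsetIr.
by move: iP p_pr; rewrite (setIidPl sPH) indexgg => <-.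
Qed.

End Transitive.

(** * The cycle set of a solution *)

Section Solution.

Variables (X : finType) (r : solution X).

(** Inverses, rather than the $\sigma_x$ themselves, make the cycle set identity
    readable with permutations composed from left to right. *)
Definition lact (x : X) : {perm X} := (sigma r x)^-1.

Lemma solE x y : r (x, y) = (sigma r x y, tau r y x).
Proof. by rewrite [LHS]surjective_pairing !permE. Qed.

Lemma sigma_tau x y : sigma r (sigma r x y) (tau r y x) = x.
Proof. by have := sol_invol r (x, y); rewrite !solE => -[]. Qed.

Lemma tau_lact x y : tau r y x = lact (sigma r x y) x.
Proof. by apply: (canRL (permK _)); rewrite sigma_tau. Qed.

Lemma sigma_braid x y :
  sigma r y * sigma r x = sigma r (tau r y x) * sigma r (sigma r x y).
Proof.
apply/permP=> z; have := sol_ybe r (x, y, z).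
rewrite /comp /ybe_r1 /ybe_r2.
by rewrite !solE /= => -[]; rewrite !permM.
Qed.

Lemma lact_cycle x y : lact x * lact (lact x y) = lact y * lact (lact y x).
Proof.
rewrite -!invMg; congr _^-1; rewrite sigma_braid permKV.
by rewrite tau_lact permKV.
Qed.

Lemma lact_square x : lact x x = (diag r)^-1 x.
Proof.
set z := lact x x; have sz : sigma r x z = x by rewrite permKV.
have tz : tau r z x = z by rewrite tau_lact sz.
by apply: (canRL (permK _)); rewrite permE /diag_fun -{2}tz permK.
Qed.

Lemma lact_square_inj : injective (fun x => lact x x).
Proof. by move=> x y; rewrite !lact_square => /perm_inj. Qed.

Lemma iter_lact_square x k :
  (iter k (fun y => lact y y) x == x) = (#|porbit (diag r) x| %| k).
Proof.
rewrite (eq_iter lact_square) -permX expgVn.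
rewrite -(inj_eq (@perm_inj _ (diag r ^+ k))) permKV permX eq_sym.
set s := diag r; set t := #|_|.
have t_gt0 : 0 < t by rewrite /t (cardD1 x) porbit_id.
have iter_t m : iter (m * t) s x = x.
  by elim: m => // m IH; rewrite mulSn iterD IH iter_porbit.
rewrite {1}(divn_eq k t) addnC iterD iter_t.
have lt_kt : k %% t < t by rewrite ltn_mod.
rewrite -(nth_traject s lt_kt) -[X in _ == X](nth_traject s t_gt0).
by rewrite (nth_uniq _ _ _ (uniq_traject_porbit s x)) ?size_traject.
Qed.

Lemma T_partitionP t :
  reflect (exists x, t = #|porbit (diag r) x|) (t \in T_partition r).
Proof.
rewrite mem_sort; apply: (iffP imageP) => [[_ /imsetP[x _ ->] ->]|[x ->]].
  by exists x.
by exists (porbit (diag r) x); rewrite ?imset_f.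
Qed.

(** An orbit of $G$ is stable under all $\sigma_x$, hence under all $\tau_y$, as
    $\tau_y(x)$ and $x$ are in the same orbit by [sigma_tau]. *)
Lemma indecomposable_transitive (G : {group {perm X}}) :
    indecomposable r -> (forall x, lact x \in G) ->
  [transitive G, on [set: X] | 'P].
Proof.
move=> indec lactG.
have [x0 _] : exists x : X, x \in X.
  by apply/card_gt0P; exact: ltnW (sol_card r).
have lactGV x : sigma r x \in G by rewrite -groupV lactG.
pose Y := orbit 'P G x0.
have Ysigma x y : (sigma r x y \in Y) = (y \in Y).
  by rewrite -[sigma r x y]/('P%act y (sigma r x)) orbit_actr.
have Ytau x y : (tau r y x \in Y) = (x \in Y).
  by rewrite -[x in RHS](sigma_tau x y) Ysigma.
apply/imsetP; exists x0; rewrite // -/Y; apply/esym/eqP; rewrite -subTset.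
apply: contra_notT indec => /subsetPn[z0 _ Y'z0].
have r_stable (Z : {set X}) : (forall x y, (sigma r x y \in Z) = (y \in Z)) ->
    (forall x y, (tau r y x \in Z) = (x \in Z)) -> r @: setX Z Z = setX Z Z.
  move=> Zs Zt; apply/eqP; rewrite eqEcard card_imset ?leqnn ?andbT.
    apply/subsetP=> _ /imsetP[[x y] /setXP[Zx Zy] ->].
    by rewrite solE in_setX Zs Zt Zx Zy.
  exact: can_inj (sol_invol r).
exists Y, (~: Y); split; split=> //.
- by apply/set0Pn; exists x0; apply: orbit_refl.
- by apply/set0Pn; exists z0; rewrite inE.
- by rewrite -setI_eq0 setICr.
- by rewrite setUCr.
- exact: r_stable.
- by apply: r_stable => x y; rewrite !inE ?Ysigma ?Ytau.
Qed.

End Solution.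

(** * Diagonal orbits of solutions of size pq *)

Lemma indecomposable_pq_orbit (X : finType) (r : solution X) (p q : nat) :
    prime p -> prime q -> p < q -> #|X| = (p * q)%N -> indecomposable r ->
    (forall x, ~~ (p %| #|porbit (diag r) x|)) ->
  forall x, q %| #|porbit (diag r) x|.
Proof.
move=> p_prime q_prime p_lt_q card_X r_indec p'T x0; apply: contraT => q'x0.
pose A := @part X (lact r) (@lact_square_inj X r).
pose u := @part_gen X (lact r) (@lact_square_inj X r).
have fix_u (l : nat) x : prime l -> ~~ (l %| #|porbit (diag r) x|) -> u l x x = x.
  move=> l_pr l'x; apply: part_gen_fix (iter_lact_square r x) _.
  by rewrite p'natE.
have Atr : [transitive A predT, on [set: X] | 'P].
  apply: (indecomposable_transitive r_indec) => x.
  exact: mem_part_predT (lact_cycle r) _ x.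
pose G := A (pred2 p q).
have hallG : (pred2 p q).-Hall(A predT) G by exact: (part_Hall (lact_cycle r)).
have [sGA pqG pq'iG] := and3P hallG.
have pqX : (pred2 p q).-nat #|X|.
  by rewrite card_X pnatM !pnatE // !inE !eqxx orbT.
have Gtr : [transitive G, on [set: X] | 'P].
  apply/(subgroup_transitiveP (in_setT x0) sGA Atr).
  apply: coprime_index_mulG; rewrite ?subsetIl // (index_point_stab Atr).
  exact: pnat_coprime pqX pq'iG.
have sylP : p.-Sylow(G) (A p).
  by apply: (part_Hall (lact_cycle r)) => l /eqP->; rewrite !inE eqxx.
have sylQ : q.-Sylow(G) (A q).
  by apply: (part_Hall (lact_cycle r)) => l /eqP->; rewrite !inE eqxx orbT.
have semireg : 'C_(A q)[x0 | 'P] = 1.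
  apply: (Sylow_semiregular Gtr p_prime q_prime p_lt_q card_X pqG sylP sylQ).
  apply: subset_trans (part_sub_gen (lact_cycle r) _ _) (genS _).
  apply/subsetP=> _ /imsetP[x _ ->]; apply/bigcupP; exists x => //.
  rewrite inE (mem_part_gen (lact_cycle r)) /=; apply/astab1P.
  exact: (fix_u p x p_prime (p'T x)).
have ux0 : u q x0 = 1.
  apply/set1P; rewrite -[set1 _]/(1 : {set {perm X}}) -semireg.
  rewrite inE (mem_part_gen (lact_cycle r)) /=.
  by apply/astab1P; exact: (fix_u q x0 q_prime q'x0).
have u1 x : u q x = 1.
  have /orbitP[g Ag <-] : x \in orbit 'P (A predT) x0 by rewrite (atransP Atr) inE.
  by rewrite /= apermE; apply: (part_gen_eq1 (lact_cycle r) ux0); rewrite -part_predT.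
have A1 : A q :=: 1.
  apply/trivgP; apply: subset_trans (part_sub_gen (lact_cycle r) _ _) _; rewrite gen_subG.
  by apply/subsetP=> g /imsetP[x _ ->]; apply/set1P; exact: (u1 x).
have q_dvd : q %| #|G|.
  apply: dvdn_trans (dvdn_indexg G 'C_G[x0 | 'P]).
  by rewrite (index_point_stab Gtr) card_X dvdn_mull.
have /esym/eqP := card_Hall sylQ.
by rewrite A1 cards1 p_part_eq1 mem_primes q_prime cardG_gt0 q_dvd.
Qed.

Local Close Scope group_scope.

Theorem theorem6 (X : finType) (r : solution X) (p q : nat)
    (p_prime : prime p) (q_prime : prime q) (p_lt_q : p < q)
    (card_X : #|X| = p * q) (r_indec : indecomposable r) :
  (forall t : nat, t \in T_partition r -> q %| t) \/
  (exists2 t : nat, t \in T_partition r & p %| t).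
Proof.
have [/hasP[t]|/hasPn p'T] := boolP (has (dvdn p) (T_partition r)).
  by right; exists t.
left=> _ /T_partitionP[x ->].
apply: (indecomposable_pq_orbit p_prime q_prime) r_indec _ x => // y.
by apply: p'T; apply/T_partitionP; exists y.
Qed.
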